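(* Let $m\ge 2$. If $M\in\mathcal{M}^0_{\mathfrak{sl}(m|1)}(1|1)$, then, in the category $\mathcal{M}^0_{\mathfrak{sl}(m|1)}(1|1)$, $$M\simeq M(\mathbf{a},\mathcal{S})\qquad\text{or}\qquad M\simeq\overline{M(\mathbf{a},\mathcal{S})}$$ for some $\mathbf{a}\in(\mathbb{C}^\times)^m$ and $\mathcal{S}\subset\{1,\dots,m\}$.
   Context: Everything is over $\mathbb{C}$. $\mathfrak{sl}(m|1)$ is the Lie superalgebra of supertraceless $(m+1)\times(m+1)$ matrices with rows and columns indexed by $\{1,\dots,m\}\cup\{\bar 1\}$; $e_{IJ}$ are the matrix units, with $e_{ij}$ even and $e_{i\bar 1},e_{\bar 1 i}$ odd, and $[x,y]=xy-(-1)^{|x||y|}yx$. Put $h_i=e_{ii}+e_{\bar 1\bar 1}$ for $1\le i\le m$; these span the Cartan subalgebra $\mathfrak{h}$, and $\mathcal{U}(\mathfrak{h})=\mathbb{C}[\mathbf{h}]=\mathbb{C}[h_1,\dots,h_m]$. For $1\le i\le m$, $\sigma_i$ is the $\mathbb{C}$-algebra automorphism of $\mathbb{C}[\mathbf{h}]$ with $\sigma_i(h_i)=h_i-1$ and $\sigma_i(h_j)=h_j$ for $j\ne i$; $\Delta=\sigma_1\cdots\sigma_m$ and $\Delta_i=\sigma_i^{-1}\Delta$. Automorphisms act entrywise on vectors and matrices. $\mathcal{M}^0_{\mathfrak{sl}(m|1)}(1|1)$ is the category whose objects are the $\mathbb{Z}_2$-graded $\mathcal{U}(\mathfrak{sl}(m|1))$-modules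 (supermodules) $M=M_{\bar 0}\oplus M_{\bar 1}$ with $M_{\bar 0}$ and $M_{\bar 1}$ each free of rank 1 over $\mathcal{U}(\mathfrak{h})$, and whose morphisms are the even (parity-preserving) homomorphisms. For $\mathbf{a}=(a_1,\dots,a_m)\in(\mathbb{C}^\times)^m$ and $\mathcal{S}\subset\{1,\dots,m\}$, both $M(\mathbf{a},\mathcal{S})$ and $\overline{M(\mathbf{a},\mathcal{S})}$ have underlying space $\mathbb{C}[\mathbf{h}]\oplus\mathbb{C}[\mathbf{h}]$ (column vectors; first summand even, second odd), with $h_i$ acting by multiplication, $e_{i\bar 1}\cdot\mathbf{f}=E_{i\bar 1}\Delta_i^{-1}(\mathbf{f})$ and $e_{\bar 1 i}\cdot\mathbf{f}=E_{\bar 1 i}\Delta_i(\mathbf{f})$ (the remaining elements act as determined by these, since the $e_{i\bar 1},e_{\bar 1 i}$ generate $\mathfrak{sl}(m|1)$), where: for $M(\mathbf{a},\mathcal{S})$: $E_{i\bar{1}} = \begin{bmatrix} 0 & a_i h_i \\ 0 & 0 \end{bmatrix}$, $E_{\bar{1}i} = \begin{bmatrix} 0 & 0 \\ a_i^{-1} & 0 \end{bmatrix}$ if $i \in \mathcal{S}$, and $E_{i\bar{1}} = \begin{bmatrix} 0 & a_i \\ 0 & 0 \end{bmatrix}$, $E_{\bar{1}i} = \begin{bmatrix} 0 & 0 \\ a_i^{-1} h_{i} & 0 \end{bmatrix}$ if $i \notin \mathcal{S}$; for $\overline{M(\mathbf{a},\mathcal{S})}$: $E_{i\bar{1}} = \begin{bmatrix}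 0 & 0 \\ a_i h_i & 0 \end{bmatrix}$, $E_{\bar{1}i} = \begin{bmatrix} 0 & a_i^{-1} \\ 0 & 0 \end{bmatrix}$ if $i \in \mathcal{S}$, and $E_{i\bar{1}} = \begin{bmatrix} 0 & 0 \\ a_i & 0 \end{bmatrix}$, $E_{\bar{1}i} = \begin{bmatrix} 0 & a_i^{-1} h_{i} \\ 0 & 0 \end{bmatrix}$ if $i \notin \mathcal{S}$. *)

(* Defs.v *)
From HB Require Import structures.
From mathcomp Require Import all_boot all_order all_algebra.
From mathcomp.multinomials Require Import mpoly.
From mathcomp Require Import ring.

Set Implicit Arguments.
Unset Strict Implicit.
Unset Printing Implicit Defensive.

Import GRing.Theory.
Local Open Scope ring_scope.

Section SpecialLinearSuperalgebra.
Variables (K : fieldType) (m : nat).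
Implicit Types (A B : 'M[K]_(m + 1)) (a b : bool).

(* Rows and columns are indexed by 'I_(m + 1): the index i in {1, ..., m}
   is [lshift 1 i] and the index \bar 1 is [rshift m ord0].  Parities are
   booleans, [true] being odd. *)
Definition strace A : K := \tr (ulsubmx A) - \tr (drsubmx A).

Definition mx_part a A : 'M[K]_(m + 1) :=
  if a then block_mx 0 (ursubmx A) (dlsubmx A) 0
  else block_mx (ulsubmx A) 0 0 (drsubmx A).

(* The bilinear extension of [x, y] = xy - (-1)^(|x||y|) yx from homogeneous
   matrices to all matrices (see [sbracket_homog]). *)
Definition sbracket A B : 'M[K]_(m + 1) :=
  \sum_(a : bool) \sum_(b : bool)
    (mx_part a A *m mx_part b B
     - (-1) ^+ (a && b) *: (mx_part b B *m mx_part a A)).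

Definition sl_pred : {pred 'M[K]_(m + 1)} := fun A => strace A == 0.

Fact sl_submod_closed : submod_closed sl_pred.
Proof.
split=> [|c A B]; rewrite !unfold_in /strace /ulsubmx /drsubmx.
  by rewrite !linear0 subr0.
move=> /eqP hA /eqP hB; rewrite !linearP /= opprD addrACA -mulrBr.
by rewrite hA hB mulr0 addr0.
Qed.
HB.instance Definition _ :=
  GRing.isSubmodClosed.Build K 'M[K]_(m + 1) sl_pred sl_submod_closed.

Record sl : predArgType := Sl { slval :> 'M[K]_(m + 1); _ : slval \in sl_pred }.
HB.instance Definition _ := [isSub for slval].
HB.instance Definition _ := [Choice of sl by <:].
HB.instance Definition _ := [SubChoice_isSubLmodule of sl by <:].

Definition sl_homog a (x : sl) : Prop := mx_part a x = x :> 'M[K]_(m + 1).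

Lemma mx_part_id a b A : mx_part a (mx_part b A) = if a == b then mx_part b A else 0.
Proof.
by case: a; case: b;
  rewrite /mx_part ?block_mxKul ?block_mxKur ?block_mxKdl ?block_mxKdr ?block_mx_eq0 //=
    -?block_mx0.
Qed.

Lemma mx_part_sum A : mx_part false A + mx_part true A = A.
Proof.
by rewrite /mx_part add_block_mx !addr0 !add0r submxK.
Qed.

Lemma sbracket_homog a b A B : mx_part a A = A -> mx_part b B = B ->
  sbracket A B = A *m B - (-1) ^+ (a && b) *: (B *m A).
Proof.
move=> <- <-; rewrite /sbracket !big_bool !mx_part_id.
by case: a; case: b;
   rewrite /= ?mulmx0 ?mul0mx ?scaler0 ?subr0 ?addr0 ?add0r ?scale1r.
Qed.

Lemma strace_is_additive : zmod_morphism strace.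
Proof.
by move=> A B; rewrite /strace /ulsubmx /drsubmx !linearB /=; ring.
Qed.
HB.instance Definition _ := GRing.isZmodMorphism.Build _ _ strace strace_is_additive.

Lemma strace_block (A : 'M[K]_m) (B : 'cV[K]_m) (C : 'rV[K]_m) (D : 'M[K]_1) :
  strace (block_mx A B C D) = \tr A - \tr D.
Proof. by rewrite /strace block_mxKul block_mxKdr. Qed.

Lemma strace_sbracket A B : strace (sbracket A B) = 0.
Proof.
rewrite /sbracket raddf_sum big1 // => a _; rewrite raddf_sum big1 // => b _.
rewrite raddfB /= /mx_part; case: a; case: b;
  rewrite /= ?expr1 ?expr0 ?scale1r ?scaleN1r ?raddfN /= !mulmx_block !strace_block
    ?mul0mx ?mulmx0 ?addr0 ?add0r ?mxtrace0 ?subr0 ?opprK //.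
- rewrite [\tr (ursubmx A *m _)]mxtrace_mulC [\tr (ursubmx B *m _)]mxtrace_mulC.
  by ring.
- by rewrite [\tr (ulsubmx A *m _)]mxtrace_mulC [\tr (drsubmx A *m _)]mxtrace_mulC subrr.
Qed.

Lemma sbracket_subproof (x y : sl) : sbracket x y \in sl_pred.
Proof. by rewrite unfold_in strace_sbracket. Qed.

Definition sl_bracket (x y : sl) : sl := Sl (sbracket_subproof x y).

Lemma sl_mx_subproof A : ulsubmx A = 0 -> drsubmx A = 0 -> A \in sl_pred.
Proof. by move=> h1 h2; rewrite unfold_in /strace h1 h2 !mxtrace0 subrr. Qed.

Lemma e_ibar_subproof (i : 'I_m) : delta_mx (lshift 1 i) (rshift m ord0) \in sl_pred.
Proof.
by apply: sl_mx_subproof; apply/matrixP=> r c;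
  rewrite !mxE ?eq_lshift ?eq_rshift ?eq_lrshift ?eq_rlshift ?andbF.
Qed.

Lemma e_bari_subproof (i : 'I_m) : delta_mx (rshift m ord0) (lshift 1 i) \in sl_pred.
Proof.
by apply: sl_mx_subproof; apply/matrixP=> r c;
  rewrite !mxE ?eq_lshift ?eq_rshift ?eq_lrshift ?eq_rlshift ?andbF.
Qed.

Lemma h_subproof (i : 'I_m) :
  delta_mx (lshift 1 i) (lshift 1 i) + delta_mx (rshift m ord0) (rshift m ord0)
    \in sl_pred.
Proof.
rewrite unfold_in /strace /mxtrace (bigD1 i) //= big1 ?big_ord1 => [|j ji];
  rewrite !mxE ?eq_lshift ?eq_rshift ?eq_lrshift ?eq_rlshift ?(negPf ji) ?eqxx ?addr0 ?add0r //=.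
by rewrite subrr.
Qed.

Definition e_ibar i : sl := Sl (e_ibar_subproof i).
Definition e_bari i : sl := Sl (e_bari_subproof i).
Definition h_ i : sl := Sl (h_subproof i).

End SpecialLinearSuperalgebra.

Section Supermodules.
Variables (K : fieldType) (m : nat).
Local Notation sl := (sl K m).

(* Z/2-graded vector spaces are pairs V0 * V1 of an even and an odd part. *)
Definition vhomog (V0 V1 : lmodType K) (c : bool) (v : V0 * V1) : Prop :=
  if c then v.1 = 0 else v.2 = 0.

(* A supermodule over the enveloping algebra U(sl(m|1)); by the universal
   property of the latter it amounts to an action of sl(m|1) by operators
   satisfying the bracket relation on homogeneous elements. *)
Record supermod := Supermod {
  sm_even : lmodType K;
  sm_odd : lmodType K;
  act : sl -> sm_even * sm_odd -> sm_even * sm_odd;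
  act_linear : forall x, linear (act x);
  act_linearl : forall v, linear (act^~ v);
  act_parity : forall a c x v,
    sl_homog a x -> vhomog c v -> vhomog (a (+) c) (act x v);
  act_bracket : forall a b x y v, sl_homog a x -> sl_homog b y ->
    act (sl_bracket x y) v
    = act x (act y v) - (-1) ^+ (a && b) *: act y (act x v) }.

Definition sm_space (M : supermod) : lmodType K := (sm_even M * sm_odd M)%type.

(* The action on M of U(h) = K[h_1, ..., h_m], the variable 'X_i acting
   as h_i. *)
Definition hmon_act (M : supermod) (k : 'X_{1..m}) (v : sm_space M) : sm_space M :=
  foldr (fun i w => iter (k i) (act (h_ K i)) w) v (enum 'I_m).

Definition hact (M : supermod) (p : {mpoly K[m]}) (v : sm_space M) : sm_space M :=
  \sum_(k <- msupp p) p@_k *: hmon_act k v.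

Definition free_rank1 (M : supermod) (c : bool) : Prop :=
  exists2 v : sm_space M, vhomog c v &
    forall w : sm_space M, vhomog c w -> exists! p : {mpoly K[m]}, hact p v = w.

(* The objects of the category M^0(1|1): each homogeneous part is free of
   rank 1 over U(h). *)
Record M0 := MkM0 {
  M0_mod :> supermod;
  M0_even : free_rank1 M0_mod false;
  M0_odd : free_rank1 M0_mod true }.

Record M0hom (M N : M0) := MkM0hom {
  hom_fun :> sm_space M -> sm_space N;
  hom_linear : linear hom_fun;
  hom_even : forall c v, vhomog c v -> vhomog c (hom_fun v);
  hom_act : forall x v, hom_fun (act x v) = act x (hom_fun v) }.

Definition M0iso (M N : M0) : Prop :=
  exists (f : M0hom M N) (g : M0hom N M), cancel f g /\ cancel g f.

End Supermodules.

(* Supermodule structures generated by the action of the odd elements: e i and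
   f i are the operators by which e_ibar i and e_bari i act. *)
Section OddGenerators.
Variables (K : fieldType) (m : nat) (V0 V1 : lmodType K).
Local Notation V := (V0 * V1)%type.
Variables e f : 'I_m -> {linear V -> V}.

(* [e_(i \bar 1), e_(\bar 1 j)] = e_ij + delta_ij e_(\bar 1 \bar 1). *)
Definition acomm i j (v : V) : V := e i (f j v) + f j (e i v).

(* Since x in sl(m|1) has x_(\bar 1 \bar 1) = \sum_i x_ii, one has
   x = \sum_ij x_ij [e_(i \bar 1), e_(\bar 1 j)] + \sum_i x_(i \bar 1) e_(i \bar 1)
       + \sum_j x_(\bar 1 j) e_(\bar 1 j). *)
Definition odd_act (x : sl K m) (v : V) : V :=
  \sum_i \sum_j slval x (lshift 1 i) (lshift 1 j) *: acomm i j v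
  + \sum_i slval x (lshift 1 i) (rshift m ord0) *: e i v
  + \sum_j slval x (rshift m ord0) (lshift 1 j) *: f j v.

Record odd_rels : Prop := OddRels {
  e_odd : forall i c v, vhomog c v -> vhomog (~~ c) (e i v);
  f_odd : forall i c v, vhomog c v -> vhomog (~~ c) (f i v);
  ee_rel : forall i k v, e i (e k v) + e k (e i v) = 0;
  ff_rel : forall i k v, f i (f k v) + f k (f i v) = 0;
  efe_rel : forall i j k v, acomm i j (e k v) - e k (acomm i j v)
     = (j == k)%:R *: e i v - (i == j)%:R *: e k v;
  eff_rel : forall i j k v, acomm i j (f k v) - f k (acomm i j v)
     = (i == j)%:R *: f k v - (i == k)%:R *: f j v }.

Hypothesis rels : odd_rels.

Let gA (A : 'M[K]_m) v := \sum_(p : 'I_m * 'I_m) A p.1 p.2 *: acomm p.1 p.2 v.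
Let gb (b : 'cV[K]_m) v := \sum_i b i 0 *: e i v.
Let gc (c : 'rV[K]_m) v := \sum_j c 0 j *: f j v.

Let actE x v : odd_act x v
  = gA (ulsubmx (slval x)) v + gb (ursubmx (slval x)) v + gc (dlsubmx (slval x)) v.
Proof.
rewrite /odd_act /gA /gb /gc; congr (_ + _ + _).
- by rewrite pair_bigA; apply: eq_bigr => i _; rewrite !mxE.
- by apply: eq_bigr => i _; rewrite !mxE.
- by apply: eq_bigr => i _; rewrite !mxE.
Qed.

Let acomm_lin i j : linear (acomm i j).
Proof.
move=> a u v; rewrite /acomm !linearP /= scalerDr !addrA; congr (_ + _).
by rewrite -!addrA; congr (_ + _); rewrite addrC.
Qed.

Let gA_lin A : linear (gA A).
Proof.
move=> a u v; rewrite /gA scaler_sumr -big_split /=; apply: eq_bigr => i _.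
by rewrite acomm_lin scalerDr !scalerA mulrC.
Qed.
Let gb_lin A : linear (gb A).
Proof.
move=> a u v; rewrite /gb scaler_sumr -big_split /=; apply: eq_bigr => i _.
by rewrite linearP scalerDr !scalerA mulrC.
Qed.
Let gc_lin A : linear (gc A).
Proof.
move=> a u v; rewrite /gc scaler_sumr -big_split /=; apply: eq_bigr => i _.
by rewrite linearP scalerDr !scalerA mulrC.
Qed.

Let gA_linl v : linear (gA^~ v).
Proof.
move=> a u w; rewrite /gA scaler_sumr -big_split /=; apply: eq_bigr => i _.
by rewrite !mxE scalerDl scalerA.
Qed.
Let gb_linl v : linear (gb^~ v).
Proof.
move=> a u w; rewrite /gb scaler_sumr -big_split /=; apply: eq_bigr => i _.
by rewrite !mxE scalerDl scalerA.
Qed.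
Let gc_linl v : linear (gc^~ v).
Proof.
move=> a u w; rewrite /gc scaler_sumr -big_split /=; apply: eq_bigr => i _.
by rewrite !mxE scalerDl scalerA.
Qed.
Let gA0 v : gA 0 v = 0.
Proof. by rewrite /gA big1 // => i _; rewrite mxE scale0r. Qed.
Let gb0 v : gb 0 v = 0.
Proof. by rewrite /gb big1 // => i _; rewrite mxE scale0r. Qed.
Let gc0 v : gc 0 v = 0.
Proof. by rewrite /gc big1 // => i _; rewrite mxE scale0r. Qed.

Lemma odd_act_linear x : linear (odd_act x).
Proof.
move=> a u v; rewrite !actE gA_lin gb_lin gc_lin !scalerDr.
by rewrite (addrACA _ _ _ (gb _ _)) (addrACA _ _ _ (gc _ _)).
Qed.

Lemma odd_act_linearl v : linear (odd_act^~ v).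
Proof.
move=> a u w; rewrite !actE.
have -> : ulsubmx (slval (a *: u + w)) = a *: ulsubmx (slval u) + ulsubmx (slval w).
  by apply/matrixP=> i j; rewrite !mxE.
have -> : ursubmx (slval (a *: u + w)) = a *: ursubmx (slval u) + ursubmx (slval w).
  by apply/matrixP=> i j; rewrite !mxE.
have -> : dlsubmx (slval (a *: u + w)) = a *: dlsubmx (slval u) + dlsubmx (slval w).
  by apply/matrixP=> i j; rewrite !mxE.
rewrite gA_linl gb_linl gc_linl !scalerDr.
by rewrite (addrACA _ _ _ (gb _ _)) (addrACA _ _ _ (gc _ _)).
Qed.

Let vhomog_sum (I : Type) (r : seq I) (k : I -> K) (F : I -> V) c :
  (forall i, vhomog c (F i)) -> vhomog c (\sum_(i <- r) k i *: F i).
Proof.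
move=> h; elim: r => [|i r IH]; first by rewrite big_nil; case: c {h}.
rewrite big_cons; move: IH (h i); set u := \sum_(_ <- _) _.
by case: c {h} => /= -> ->; rewrite scaler0 addr0.
Qed.

Lemma odd_act_parity a c x v :
  sl_homog a x -> vhomog c v -> vhomog (a (+) c) (odd_act x v).
Proof.
rewrite /sl_homog => hx hv; rewrite actE -hx /mx_part.
case: a {hx} => /=; rewrite block_mxKul block_mxKur block_mxKdl.
  have h1 : vhomog (~~ c) (gb (ursubmx (slval x)) v).
    by apply: vhomog_sum => i; apply: e_odd.
  have h2 : vhomog (~~ c) (gc (dlsubmx (slval x)) v).
    by apply: vhomog_sum => i; apply: f_odd.
  by rewrite gA0 add0r; case: c h1 h2 {hv} => /= -> ->; rewrite addr0.
rewrite gb0 gc0 !addr0.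
apply: vhomog_sum => -[i j] /=.
have h1 : vhomog c (e i (f j v)).
  by rewrite -(negbK c); apply: (e_odd rels); apply: (f_odd rels).
have h2 : vhomog c (f j (e i v)).
  by rewrite -(negbK c); apply: (f_odd rels); apply: (e_odd rels).
by rewrite /acomm; case: c h1 h2 {hv} => /= -> ->; rewrite addr0.
Qed.

Let lin_sum (L : finType) (k : L -> K) (F : L -> V) (u : V -> V) : linear u ->
  u (\sum_l k l *: F l) = \sum_l k l *: u (F l).
Proof.
move=> lu; have u0 : u 0 = 0.
  by have := lu 1 0 0; rewrite !scale1r addr0 => /(congr1 (+%R^~ (- u 0))); rewrite subrr addrK.
by elim: (index_enum L) => [|l r IH]; rewrite ?big_nil ?big_cons // lu IH.
Qed.

Let gg_rel (I J : finType) (al : I -> K) (be : J -> K)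
    (g : I -> V -> V) (g' : J -> V -> V) (s : K) v :
  (forall i, linear (g i)) -> (forall j, linear (g' j)) ->
  \sum_i al i *: g i (\sum_j be j *: g' j v)
    - s *: (\sum_j be j *: g' j (\sum_i al i *: g i v))
  = \sum_i \sum_j (al i * be j) *: (g i (g' j v) - s *: g' j (g i v)).
Proof.
move=> lg lg'; under eq_bigr => i _ do rewrite lin_sum // scaler_sumr.
under [X in _ *: X]eq_bigr => j _ do rewrite lin_sum // scaler_sumr.
rewrite [X in _ *: X]exchange_big /= scaler_sumr -sumrB; apply: eq_bigr => i _.
rewrite scaler_sumr -sumrB; apply: eq_bigr => j _.
rewrite scalerBr !scalerA; congr (_ - _ *: _).
by ring.
Qed.

Let acomm_acomm i j k l v :
  acomm i j (acomm k l v) - acomm k l (acomm i j v)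
  = (j == k)%:R *: acomm i l v - (i == l)%:R *: acomm k j v.
Proof.
have r3 w a : acomm i j (e a w)
    = e a (acomm i j w) + ((j == a)%:R *: e i w - (i == j)%:R *: e a w).
  by rewrite -(efe_rel rels) addrC subrK.
have r4 w a : acomm i j (f a w)
    = f a (acomm i j w) + ((i == j)%:R *: f a w - (i == a)%:R *: f j w).
  by rewrite -(eff_rel rels) addrC subrK.
have h1 : acomm i j (e k (f l v)) = e k (f l (acomm i j v))
    + ((j == k)%:R *: e i (f l v) - (i == l)%:R *: e k (f j v)).
  rewrite r3 r4 linearD linearB !linearZ /= ?scalerN -addrA; congr (_ + _).
  by rewrite [LHS]addrC addrA subrK.
have h2 : acomm i j (f l (e k v)) = f l (e k (acomm i j v))
    + ((j == k)%:R *: f l (e i v) - (i == l)%:R *: f j (e k v)).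
  rewrite r4 r3 linearD linearB !linearZ /= ?scalerN -addrA; congr (_ + _).
  by rewrite addrA subrK.
have -> : acomm i j (acomm k l v) = acomm i j (e k (f l v)) + acomm i j (f l (e k v)).
  by have := acomm_lin i j 1 (e k (f l v)) (f l (e k v)); rewrite !scale1r.
rewrite h1 h2 {3}/acomm addrACA [X in X - _]addrC addrK.
by rewrite addrACA -opprD -!scalerDr.
Qed.

Let AA A B v : gA A (gA B v) - gA B (gA A v) = gA (A *m B - B *m A) v.
Proof.
have := @gg_rel _ _ (fun p => A p.1 p.2) (fun p => B p.1 p.2)
  (fun p => acomm p.1 p.2) (fun p => acomm p.1 p.2) 1 v
  (fun p => acomm_lin p.1 p.2) (fun p => acomm_lin p.1 p.2).
rewrite scale1r -!/(gA _ _) => ->.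
under eq_bigr => p _ do under eq_bigr => q _ do
  rewrite scale1r acomm_acomm scalerBr !scalerA.
under eq_bigr => p _ do rewrite sumrB.
rewrite sumrB -(pair_bigA _ (fun i j => \sum_(q : 'I_m * 'I_m) (A i j * B q.1 q.2 * (j == q.1)%:R) *: acomm i q.2 v)) /=.
rewrite -(pair_bigA _ (fun i j => \sum_(q : 'I_m * 'I_m) (A i j * B q.1 q.2 * (i == q.2)%:R) *: acomm q.1 j v)) /=.
transitivity (gA (A *m B) v - gA (B *m A) v); last first.
  by rewrite addrC -scaleN1r -gA_linl scaleN1r addrC.
congr (_ - _).
  rewrite /gA -(pair_bigA _ (fun i l => (A *m B) i l *: acomm i l v)) /=.
  apply: eq_bigr => i _.
  under eq_bigr => j _ do rewrite -(pair_bigA _ (fun k l => (A i j * B k l * (j == k)%:R) *: acomm i l v)) /=.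
  under eq_bigr => j _ do rewrite exchange_big /=.
  rewrite exchange_big /=; apply: eq_bigr => l _.
  rewrite mxE scaler_suml; apply: eq_bigr => j _.
  rewrite (bigD1 j) //= eqxx mulr1 big1 ?addr0 // => k /negPf kj.
  by rewrite eq_sym kj mulr0 scale0r.
rewrite /gA -(pair_bigA _ (fun k j => (B *m A) k j *: acomm k j v)) /=.
under eq_bigr => i _ do under eq_bigr => j _ do rewrite -(pair_bigA _ (fun k l => (A i j * B k l * (i == l)%:R) *: acomm k j v)) /=.
under eq_bigr => i _ do rewrite exchange_big /=.
rewrite exchange_big /=; apply: eq_bigr => k _.
rewrite exchange_big /=; apply: eq_bigr => j _.
rewrite mxE scaler_suml; apply: eq_bigr => i _.
rewrite (bigD1 i) //= eqxx mulr1 mulrC big1 ?addr0 // => l /negPf li.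
by rewrite eq_sym li mulr0 scale0r.
Qed.

Let Ab A b v : gA A (gb b v) - gb b (gA A v) = gb (A *m b - \tr A *: b) v.
Proof.
have := @gg_rel _ _ (fun p => A p.1 p.2) (fun i => b i 0)
  (fun p => acomm p.1 p.2) (fun i => e i) 1 v
  (fun p => acomm_lin p.1 p.2) (fun i => linearP (e i)).
rewrite scale1r -!/(gb _ _) -!/(gA _ _) => ->.
under eq_bigr => p _ do under eq_bigr => q _ do
  rewrite scale1r (efe_rel rels) scalerBr !scalerA.
under eq_bigr => p _ do rewrite sumrB.
rewrite sumrB.
transitivity (gb (A *m b) v - gb (\tr A *: b) v); last first.
  by rewrite addrC -scaleN1r -gb_linl scaleN1r addrC.
congr (_ - _).
  rewrite -(pair_bigA _ (fun i j => \sum_k (A i j * b k 0 * (j == k)%:R) *: e i v)) /=.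
  apply: eq_bigr => i _.
  rewrite mxE scaler_suml; apply: eq_bigr => j _.
  rewrite (bigD1 j) //= eqxx mulr1 big1 ?addr0 // => k /negPf kj.
  by rewrite eq_sym kj mulr0 scale0r.
rewrite -(pair_bigA _ (fun i j => \sum_k (A i j * b k 0 * (i == j)%:R) *: e k v)) /=.
under eq_bigr => i _ do rewrite exchange_big /=.
rewrite exchange_big /=; apply: eq_bigr => k _.
rewrite mxE mulr_suml scaler_suml; apply: eq_bigr => i _.
rewrite (bigD1 i) //= eqxx mulr1 big1 ?addr0 // => l /negPf li.
by rewrite eq_sym li mulr0 scale0r.
Qed.

Let Ac A c v : gA A (gc c v) - gc c (gA A v) = gc (\tr A *: c - c *m A) v.
Proof.
have := @gg_rel _ _ (fun p => A p.1 p.2) (fun i => c 0 i)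
  (fun p => acomm p.1 p.2) (fun i => f i) 1 v
  (fun p => acomm_lin p.1 p.2) (fun i => linearP (f i)).
rewrite scale1r -!/(gc _ _) -!/(gA _ _) => ->.
under eq_bigr => p _ do under eq_bigr => q _ do
  rewrite scale1r (eff_rel rels) scalerBr !scalerA.
under eq_bigr => p _ do rewrite sumrB.
rewrite sumrB.
transitivity (gc (\tr A *: c) v - gc (c *m A) v); last first.
  by rewrite addrC -scaleN1r -gc_linl scaleN1r addrC.
congr (_ - _).
  rewrite -(pair_bigA _ (fun i j => \sum_k (A i j * c 0 k * (i == j)%:R) *: f k v)) /=.
  under eq_bigr => i _ do rewrite exchange_big /=.
  rewrite exchange_big /=; apply: eq_bigr => k _.
  rewrite mxE mulr_suml scaler_suml; apply: eq_bigr => i _.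
  rewrite (bigD1 i) //= eqxx mulr1 big1 ?addr0 // => l /negPf li.
  by rewrite eq_sym li mulr0 scale0r.
rewrite -(pair_bigA _ (fun i j => \sum_k (A i j * c 0 k * (i == k)%:R) *: f j v)) /=.
rewrite exchange_big /=; apply: eq_bigr => j _.
rewrite mxE scaler_suml; apply: eq_bigr => i _.
rewrite (bigD1 i) //= eqxx mulr1 mulrC big1 ?addr0 // => k /negPf ki.
by rewrite eq_sym ki mulr0 scale0r.
Qed.

Let bb b b' v : gb b (gb b' v) + gb b' (gb b v) = 0.
Proof.
have := @gg_rel _ _ (fun i => b i 0) (fun i => b' i 0)
  (fun i => e i) (fun i => e i) (-1) v
  (fun i => linearP (e i)) (fun i => linearP (e i)).
rewrite scaleN1r opprK -!/(gb _ _) => ->.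
rewrite big1 // => i _; rewrite big1 // => j _.
by rewrite scaleN1r opprK (ee_rel rels) scaler0.
Qed.

Let cc c c' v : gc c (gc c' v) + gc c' (gc c v) = 0.
Proof.
have := @gg_rel _ _ (fun i => c 0 i) (fun i => c' 0 i)
  (fun i => f i) (fun i => f i) (-1) v
  (fun i => linearP (f i)) (fun i => linearP (f i)).
rewrite scaleN1r opprK -!/(gc _ _) => ->.
rewrite big1 // => i _; rewrite big1 // => j _.
by rewrite scaleN1r opprK (ff_rel rels) scaler0.
Qed.

Let bc b c v : gb b (gc c v) + gc c (gb b v) = gA (b *m c) v.
Proof.
have := @gg_rel _ _ (fun i => b i 0) (fun i => c 0 i)
  (fun i => e i) (fun i => f i) (-1) v
  (fun i => linearP (e i)) (fun i => linearP (f i)).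
rewrite scaleN1r opprK -!/(gb _ _) -!/(gc _ _) => ->.
rewrite /gA -(pair_bigA _ (fun i j => (b *m c) i j *: acomm i j v)) /=.
apply: eq_bigr => i _; apply: eq_bigr => j _.
by rewrite scaleN1r opprK mxE big_ord1.
Qed.

Let sl_dr (x : sl K m) : drsubmx (slval x) = (\tr (ulsubmx (slval x)))%:M.
Proof.
have := valP x; rewrite unfold_in /strace subr_eq0 => /eqP ->.
by rewrite /mxtrace big_ord1 -mx11_scalar.
Qed.

Lemma odd_act_bracket a b x y v : sl_homog a x -> sl_homog b y ->
  odd_act (sl_bracket x y) v
  = odd_act x (odd_act y v) - (-1) ^+ (a && b) *: odd_act y (odd_act x v).
Proof.
move=> hx hy.
have ac (p q p' q' r r' t t' : V) : r + r' = 0 -> t + t' = 0 ->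
    p + q + (p' + q') = r + p + (q' + t) + (r' + p' + (q + t')).
  move=> hr ht; rewrite [RHS](AC ((2*2)*(2*2)) ((1*5)*(4*8)*((2*7)*(6*3)))) /=.
  by rewrite hr ht !add0r.
have odd_act0 : odd_act 0 v = 0.
  have := odd_act_linearl v 1 0 0; rewrite /= !scale1r addr0 => h.
  by apply: (addIr (odd_act 0 v)); rewrite add0r -h.
have actE0 u z : sl_homog false u -> odd_act u z = gA (ulsubmx (slval u)) z.
  by move=> hu; rewrite actE -hu /= block_mxKul block_mxKur block_mxKdl gb0 gc0 !addr0.
have actE1 u z : sl_homog true u ->
    odd_act u z = gb (ursubmx (slval u)) z + gc (dlsubmx (slval u)) z.
  by move=> hu; rewrite actE -hu /= block_mxKul block_mxKur block_mxKdl gA0 add0r.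
have even_odd u w z : sl_homog false u -> sl_homog true w ->
    odd_act (sl_bracket u w) z = odd_act u (odd_act w z) - odd_act w (odd_act u z).
  move=> hu hw; rewrite [LHS]actE /= (sbracket_homog hu hw) expr0 scale1r.
  rewrite !(actE0 u) // !(actE1 w) //.
  have := gA_lin (ulsubmx (slval u)) 1 (gb (ursubmx (slval w)) z) (gc (dlsubmx (slval w)) z).
  rewrite !scale1r => ->; rewrite opprD addrACA Ab Ac.
  rewrite -hu -hw /mx_part !mulmx_block opp_block_mx add_block_mx.
  rewrite !block_mxKul !block_mxKur !block_mxKdl.
  rewrite !(mulmx0, mul0mx, addr0, add0r, subr0, oppr0) gA0 add0r.
  by rewrite sl_dr mul_scalar_mx mul_mx_scalar.
case: a b hx hy => -[] hx hy; rewrite /= ?expr0 ?expr1 ?scale1r ?scaleN1r ?opprK.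
- rewrite [LHS]actE /= (sbracket_homog hx hy) expr1 scaleN1r opprK.
  rewrite !(actE1 x) // !(actE1 y) //.
  have hb w z1 z2 : gb w (z1 + z2) = gb w z1 + gb w z2.
    by have := gb_lin w 1 z1 z2; rewrite !scale1r.
  have hc w z1 z2 : gc w (z1 + z2) = gc w z1 + gc w z2.
    by have := gc_lin w 1 z1 z2; rewrite !scale1r.
  have hA w z1 z2 : gA (z1 + z2) w = gA z1 w + gA z2 w.
    by have := gA_linl w 1 z1 z2; rewrite !scale1r.
  rewrite !hb !hc -hx -hy /mx_part !mulmx_block add_block_mx.
  rewrite !block_mxKul !block_mxKur !block_mxKdl.
  rewrite !(mulmx0, mul0mx, addr0, add0r, subr0, oppr0) gb0 gc0 !addr0.
  by rewrite hA -!bc; apply: ac; [apply: bb | apply: cc].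
- have -> : sl_bracket x y = (-1) *: sl_bracket y x + 0.
    apply: val_inj; rewrite /= addr0 scaleN1r (sbracket_homog hx hy).
    by rewrite (sbracket_homog hy hx) !expr0 !scale1r opprB.
  have := odd_act_linearl v (-1) (sl_bracket y x) 0; rewrite /= => ->.
  by rewrite odd_act0 addr0 scaleN1r (even_odd _ _ _ hy hx) opprB.
- exact: even_odd.
rewrite [LHS]actE /= (sbracket_homog hx hy) expr0 scale1r.
rewrite !(actE0 x) // !(actE0 y) // AA -hx -hy /mx_part !mulmx_block.
rewrite opp_block_mx add_block_mx.
rewrite !block_mxKul !block_mxKur !block_mxKdl.
by rewrite !(mulmx0, mul0mx, addr0, add0r, subr0, oppr0) gb0 gc0 !addr0.
Qed.

End OddGenerators.

Section OddGeneratedSupermodule.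
Variables (K : fieldType) (m : nat) (V0 V1 : lmodType K).
Variables e f : 'I_m -> {linear (V0 * V1)%type -> (V0 * V1)%type}.

Definition odd_supermod (rels : odd_rels e f) : supermod K m :=
  Supermod (@odd_act_linear _ _ _ _ e f) (@odd_act_linearl _ _ _ _ e f)
    (odd_act_parity rels) (odd_act_bracket rels).

Lemma odd_act_ibar (rels : odd_rels e f) i (v : sm_space (odd_supermod rels)) :
  act (e_ibar K i) v = e i v.
Proof.
rewrite /= /odd_act big1 ?add0r => [|j _]; last first.
  by rewrite big1 // => k _; rewrite mxE eq_lrshift andbF scale0r.
rewrite (bigD1 i) //= mxE !eqxx scale1r !big1 ?addr0 // => [j _|j /negPf ji].
  by rewrite mxE eq_rlshift scale0r.
by rewrite mxE eq_lshift ji scale0r.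
Qed.

Lemma odd_act_bari (rels : odd_rels e f) i (v : sm_space (odd_supermod rels)) :
  act (e_bari K i) v = f i v.
Proof.
rewrite /= /odd_act big1 ?add0r => [|j _]; last first.
  by rewrite big1 // => k _; rewrite mxE eq_lrshift scale0r.
rewrite (bigD1 i) //= big1 => [|j _]; last by rewrite mxE eq_lrshift scale0r.
rewrite mxE eq_lrshift scale0r !add0r.
rewrite (bigD1 i) //= mxE !eqxx scale1r !big1 ?addr0 // => j /negPf ji.
by rewrite mxE eq_lshift ji andbF scale0r.
Qed.

Lemma odd_act_h (rels : odd_rels e f) i (v : sm_space (odd_supermod rels)) :
  act (h_ K i) v = e i (f i v) + f i (e i v).
Proof.
rewrite /= /odd_act (bigD1 i) //= (bigD1 i) //=.
rewrite !mxE !eqxx !eq_lrshift /= addr0 scale1r.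
rewrite big1 => [|j /negPf ji]; last first.
  by rewrite !mxE !eq_lshift ji !eq_lrshift andbF addr0 scale0r.
rewrite big1 => [|j /negPf ji]; last first.
  by rewrite big1 // => k _; rewrite !mxE !eq_lshift ji !eq_lrshift addr0 scale0r.
rewrite big1 => [|j _]; last by rewrite !mxE !eq_rlshift !eq_lrshift !andbF addr0 scale0r.
rewrite big1 => [|j _]; first by rewrite !addr0.
by rewrite !mxE !eq_lrshift !eq_rlshift !andbF addr0 scale0r.
Qed.

End OddGeneratedSupermodule.

Section OddRels.
Variables (K : fieldType) (m : nat) (V0 V1 : lmodType K).
Variables e f : 'I_m -> {linear (V0 * V1)%type -> (V0 * V1)%type}.

Let eqp (x y : V0 * V1) : x.1 = y.1 -> x.2 = y.2 -> x = y.
Proof. by case: x y => [? ?] [? ?] /= -> ->. Qed.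

Lemma odd_rels_upper (X : 'I_m -> V1 -> V0) (Y : 'I_m -> V0 -> V1) :
  (forall i, X i 0 = 0) -> (forall i, Y i 0 = 0) ->
  (forall i j k p, X i (Y j (X k p)) - X k (Y j (X i p))
    = (j == k)%:R *: X i p - (i == j)%:R *: X k p) ->
  (forall i j k p, Y j (X i (Y k p)) - Y k (X i (Y j p))
    = (i == j)%:R *: Y k p - (i == k)%:R *: Y j p) ->
  (forall i v, e i v = (X i v.2, 0)) -> (forall i v, f i v = (0, Y i v.1)) ->
  odd_rels e f.
Proof.
move=> X0 Y0 XYX YXY eE fE.
split=> [i [] [v0 v1]|i [] [v0 v1]|i k v|i k v|i j k v|i j k v];
  rewrite /acomm ?eE ?fE /= ?X0 ?Y0 ?addr0 ?add0r //.
- by move=> ->; rewrite X0.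
- by move=> ->; rewrite Y0.
- by apply: eqp; [exact: XYX | rewrite /= !scaler0].
- apply: eqp; rewrite /=; first by rewrite X0 addr0 !scaler0.
  by rewrite add0r YXY.
Qed.

Lemma odd_rels_lower (X : 'I_m -> V0 -> V1) (Y : 'I_m -> V1 -> V0) :
  (forall i, X i 0 = 0) -> (forall i, Y i 0 = 0) ->
  (forall i j k p, X i (Y j (X k p)) - X k (Y j (X i p))
    = (j == k)%:R *: X i p - (i == j)%:R *: X k p) ->
  (forall i j k p, Y j (X i (Y k p)) - Y k (X i (Y j p))
    = (i == j)%:R *: Y k p - (i == k)%:R *: Y j p) ->
  (forall i v, e i v = (0, X i v.1)) -> (forall i v, f i v = (Y i v.2, 0)) ->
  odd_rels e f.
Proof.
move=> X0 Y0 XYX YXY eE fE.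
split=> [i [] [v0 v1]|i [] [v0 v1]|i k v|i k v|i j k v|i j k v];
  rewrite /acomm ?eE ?fE /= ?X0 ?Y0 ?addr0 ?add0r //.
- by move=> ->; rewrite X0.
- by move=> ->; rewrite Y0.
- by apply: eqp; [rewrite /= !scaler0 | exact: XYX].
- apply: eqp; rewrite /=; last by rewrite X0 addr0 !scaler0.
  by rewrite add0r YXY.
Qed.

End OddRels.

Section Models.
Variables (K : fieldType) (m : nat).
Local Notation P := {mpoly K[m]}.

(* The K-algebra endomorphism h_j |-> h_j - d_j of K[h_1, ..., h_m]. *)
Definition shift (d : 'I_m -> K) (p : P) : P :=
  p \mPo [tuple 'X_j - (d j)%:MP | j < m].

Definition sigma (i : 'I_m) : P -> P := shift (fun j => (j == i)%:R).
Definition sigmaV (i : 'I_m) : P -> P := shift (fun j => - (j == i)%:R).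

Definition Delta (p : P) : P := foldr sigma p (enum 'I_m).
Definition DeltaV (p : P) : P := foldr sigmaV p (enum 'I_m).

(* Delta_i = sigma_i^-1 Delta and its inverse. *)
Definition Delta_ (i : 'I_m) (p : P) : P := sigmaV i (Delta p).
Definition DeltaV_ (i : 'I_m) (p : P) : P := sigma i (DeltaV p).

Lemma shiftX d j : shift d 'X_j = 'X_j - (d j)%:MP.
Proof. by rewrite /shift comp_mpolyXU -tnth_nth tnth_mktuple. Qed.

Lemma shiftC d c : shift d c%:MP = c%:MP.
Proof. exact: comp_mpolyC. Qed.

Lemma shiftM d : {morph shift d : p q / p * q}.
Proof. exact: rmorphM. Qed.

Lemma shift_linear d : linear (shift d).
Proof. exact: linearP. Qed.

Lemma shift_shift d d' p : shift d (shift d' p) = shift (fun j => d j + d' j) p.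
Proof.
rewrite /shift [p \mPo _]comp_mpolyE [RHS]comp_mpolyE raddf_sum /=.
apply: eq_bigr => k _; rewrite comp_mpolyZ rmorph_prod /=; congr (_ *: _).
apply: eq_bigr => j _; rewrite rmorphXn /=; congr (_ ^+ _).
rewrite !tnth_mktuple -/(shift d _) /shift raddfB /= comp_mpolyC.
by rewrite comp_mpolyXU -tnth_nth tnth_mktuple mpolyCD opprD addrA.
Qed.

Lemma eq_shift d d' : d =1 d' -> shift d =1 shift d'.
Proof.
move=> h p; rewrite /shift; congr (_ \mPo _).
by apply: eq_from_tnth => j; rewrite !tnth_mktuple h.
Qed.

Lemma shift0 d p : d =1 (fun _ => 0) -> shift d p = p.
Proof.
move=> h; rewrite (eq_shift h) /shift -[RHS]comp_mpoly_id; congr (_ \mPo _).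
by apply: eq_from_tnth => j; rewrite !tnth_mktuple mpolyC0 subr0.
Qed.

Lemma foldr_shift (D : 'I_m -> 'I_m -> K) p s :
  foldr (fun i => shift (D i)) p s = shift (fun j => \sum_(i <- s) D i j) p.
Proof.
elim: s => [|i s IH] /=; first by rewrite shift0 // => j; rewrite big_nil.
by rewrite IH shift_shift; apply: eq_shift => j; rewrite big_cons.
Qed.

Lemma DeltaE p : Delta p = shift (fun _ => 1) p.
Proof.
rewrite /Delta foldr_shift; apply: eq_shift => j; rewrite big_enum /=.
by rewrite (bigD1 j) //= eqxx big1 ?addr0 // => i /negPf; rewrite eq_sym => ->.
Qed.

Lemma DeltaVE p : DeltaV p = shift (fun _ => -1) p.
Proof.
rewrite /DeltaV foldr_shift; apply: eq_shift => j; rewrite big_enum /=.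
by rewrite (bigD1 j) //= eqxx big1 ?addr0 // => i /negPf; rewrite eq_sym => ->; rewrite oppr0.
Qed.

Lemma Delta_E i p : Delta_ i p = shift (fun j => (j != i)%:R) p.
Proof.
rewrite /Delta_ DeltaE /sigmaV shift_shift; apply: eq_shift => j.
by case: (j == i); rewrite /= ?oppr0 ?add0r // addNr.
Qed.

Lemma DeltaV_E i p : DeltaV_ i p = shift (fun j => - (j != i)%:R) p.
Proof.
rewrite /DeltaV_ DeltaVE /sigma shift_shift; apply: eq_shift => j.
by case: (j == i); rewrite /= ?oppr0 ?add0r // addrN.
Qed.

Lemma Delta_K i : cancel (Delta_ i) (DeltaV_ i).
Proof.
by move=> p; rewrite DeltaV_E Delta_E shift_shift shift0 // => j; rewrite addNr.
Qed.

Lemma DeltaV_K i : cancel (DeltaV_ i) (Delta_ i).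
Proof.
by move=> p; rewrite DeltaV_E Delta_E shift_shift shift0 // => j; rewrite addrN.
Qed.

(* The matrices [0 g; 0 0] and [0 0; g 0] composed with the entrywise action
   of t, on column vectors (f_0, f_1). *)
Definition upper (g : P) (t : P -> P) (v : P * P) : P * P := (g * t v.2, 0).
Definition lower (g : P) (t : P -> P) (v : P * P) : P * P := (0, g * t v.1).

Lemma upper_linear g d : linear (upper g (shift d)).
Proof.
move=> c [u1 u2] [v1 v2]; rewrite /upper /= shift_linear.
by congr pair; rewrite /= ?mulrDr ?scalerAr // scaler0 addr0.
Qed.

Lemma lower_linear g d : linear (lower g (shift d)).
Proof.
move=> c [u1 u2] [v1 v2]; rewrite /lower /= shift_linear.
by congr pair; rewrite /= ?mulrDr ?scalerAr // scaler0 addr0.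
Qed.

Lemma upper_eq g t t' : t =1 t' -> linear (upper g t') -> linear (upper g t).
Proof. by move=> h l c u v; rewrite /upper !h; apply: l. Qed.

Lemma lower_eq g t t' : t =1 t' -> linear (lower g t') -> linear (lower g t).
Proof. by move=> h l c u v; rewrite /lower !h; apply: l. Qed.

Variables (a : 'I_m -> K) (S : {set 'I_m}).

(* The nonzero entries of the matrices E_(i \bar 1) and E_(\bar 1 i); they are
   the same for M(a, S) and for its barred version. *)
Definition entry_ibar (i : 'I_m) : P := if i \in S then a i *: 'X_i else (a i)%:MP.
Definition entry_bari (i : 'I_m) : P :=
  if i \in S then ((a i)^-1)%:MP else (a i)^-1 *: 'X_i.

Definition e_op i : P * P -> P * P := upper (entry_ibar i) (DeltaV_ i).
Definition f_op i : P * P -> P * P := lower (entry_bari i) (Delta_ i).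
Definition e_opbar i : P * P -> P * P := lower (entry_ibar i) (DeltaV_ i).
Definition f_opbar i : P * P -> P * P := upper (entry_bari i) (Delta_ i).

HB.instance Definition _ i := GRing.isLinear.Build K (P * P)%type (P * P)%type _
  (e_op i) (upper_eq (DeltaV_E i) (upper_linear _ _)).
HB.instance Definition _ i := GRing.isLinear.Build K (P * P)%type (P * P)%type _
  (f_op i) (lower_eq (Delta_E i) (lower_linear _ _)).
HB.instance Definition _ i := GRing.isLinear.Build K (P * P)%type (P * P)%type _
  (e_opbar i) (lower_eq (DeltaV_E i) (lower_linear _ _)).
HB.instance Definition _ i := GRing.isLinear.Build K (P * P)%type (P * P)%type _
  (f_opbar i) (upper_eq (Delta_E i) (upper_linear _ _)).

Hypothesis a_neq0 : forall i, a i != 0.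

Let X i p := entry_ibar i * DeltaV_ i p.
Let Y i p := entry_bari i * Delta_ i p.

Let entry_ibarE i : entry_ibar i = (a i)%:MP * (if i \in S then 'X_i else 1).
Proof. by rewrite /entry_ibar; case: ifP; rewrite ?mulr1 // mul_mpolyC. Qed.
Let entry_bariE i : entry_bari i = (a i)^-1%:MP * (if i \in S then 1 else 'X_i).
Proof. by rewrite /entry_bari; case: ifP; rewrite ?mulr1 // mul_mpolyC. Qed.

Let aK i : (a i)%:MP * (a i)^-1%:MP = 1 :> P.
Proof. by rewrite -mpolyCM divff. Qed.

Let shift1 d : shift d 1 = 1.
Proof. by rewrite -mpolyC1 shiftC. Qed.

Let sX (b : bool) d i : shift d (if b then 'X_i else 1) = if b then 'X_i - (d i)%:MP else 1.
Proof. by case: b; rewrite ?shiftX ?shift1. Qed.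
Let sX' (b : bool) d i : shift d (if b then 1 else 'X_i) = if b then 1 else 'X_i - (d i)%:MP.
Proof. by case: b; rewrite ?shiftX ?shift1. Qed.

Let bE (b : bool) : b%:R%:MP = b%:R :> P.
Proof. by case: b; rewrite ?mpolyC0 ?mpolyC1. Qed.

Let cE := (bE, mpolyCD, mpolyCN, mpolyC0, mpolyC1).

Let XYX i j k p :
  X i (Y j (X k p)) - X k (Y j (X i p)) = (j == k)%:R *: X i p - (i == j)%:R *: X k p.
Proof.
have [<-|nik] := eqVneq i k; first by rewrite !subrr eq_sym subrr.
rewrite /X /Y !DeltaV_E !Delta_E !entry_ibarE !entry_bariE.
rewrite !(shiftM, shiftC, shift_shift, sX, sX') !cE.
set q1 := shift _ p; set q2 := shift _ p; set qi := shift _ p; set qk := shift _ p.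
have q12 : q2 = q1 by apply: eq_shift => l; ring.
rewrite {}q12 {q2} (eq_sym k) !(negbTE nik).
move: @q1 @qi @qk nik; have [<-|njk] := eqVneq j k => q1 qi qk nik.
  have -> : q1 = qi by apply: eq_shift => l; ring.
  rewrite scale1r (eq_sym j) (negbTE nik) scale0r subr0.
  transitivity ((a j)%:MP * (a j)^-1%:MP * ((a i)%:MP * (if i \in S then 'X_i else 1) * qi)).
    by rewrite /=; case: (i \in S); case: (j \in S); ring.
  by rewrite aK mul1r ?subr0.
move: @q1 @qi @qk nik; have [->|nij] := eqVneq i j => q1 qi qk nik.
  have -> : q1 = qk by apply: eq_shift => l; ring.
  rewrite scale1r scale0r sub0r.
  transitivity (- ((a j)%:MP * (a j)^-1%:MP * ((a k)%:MP * (if k \in S then 'X_k else 1) * qk))).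
    by rewrite /= ?(eq_sym k) ?(negbTE njk) /=; case: (j \in S); case: (k \in S); ring.
  by rewrite aK mul1r ?subr0.
rewrite !scale0r subr0 ?(eq_sym j i) ?(negbTE nij) ?(negbTE njk) ?(eq_sym k) ?(negbTE njk) /=.
by case: (i \in S); case: (j \in S); case: (k \in S); ring.
Qed.

Let YXY i j k p :
  Y j (X i (Y k p)) - Y k (X i (Y j p)) = (i == j)%:R *: Y k p - (i == k)%:R *: Y j p.
Proof.
have [<-|njk] := eqVneq j k; first by rewrite !subrr.
rewrite /X /Y !DeltaV_E !Delta_E !entry_ibarE !entry_bariE.
rewrite !(shiftM, shiftC, shift_shift, sX, sX') !cE.
set q1 := shift _ p; set q2 := shift _ p; set qk := shift _ p; set qj := shift _ p.
have q12 : q2 = q1 by apply: eq_shift => l; ring.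
rewrite {}q12 {q2} (eq_sym k) !(negbTE njk).
move: @q1 @qj @qk njk; have [->|nij] := eqVneq i j => q1 qj qk njk.
  have -> : q1 = qk by apply: eq_shift => l; ring.
  rewrite scale1r (negbTE njk) scale0r subr0.
  transitivity ((a j)%:MP * (a j)^-1%:MP *
      ((a k)^-1%:MP * (if k \in S then 1 else 'X_k) * qk)).
    by rewrite /= ?(eq_sym k) ?(negbTE njk) /=; case: (j \in S); case: (k \in S); ring.
  by rewrite aK mul1r ?subr0.
move: @q1 @qj @qk njk; have [->|nik] := eqVneq i k => q1 qj qk njk.
  have -> : q1 = qj by apply: eq_shift => l; ring.
  rewrite scale1r scale0r sub0r.
  transitivity (- ((a k)%:MP * (a k)^-1%:MP *
      ((a j)^-1%:MP * (if j \in S then 1 else 'X_j) * qj))).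
    by rewrite /= ?(eq_sym k) ?(negbTE njk) /=; case: (j \in S); case: (k \in S); ring.
  by rewrite aK mul1r ?subr0.
rewrite !scale0r subr0 ?(eq_sym j i) ?(eq_sym k i) ?(negbTE nij) ?(negbTE nik) /=.
by case: (i \in S); case: (j \in S); case: (k \in S); ring.
Qed.

Let eqp (x y : P * P) : x.1 = y.1 -> x.2 = y.2 -> x = y.
Proof. by case: x y => [? ?] [? ?] /= -> ->. Qed.

Let X0 i : X i 0 = 0.
Proof. by rewrite /X DeltaV_E /shift comp_mpoly0 mulr0. Qed.
Let Y0 i : Y i 0 = 0.
Proof. by rewrite /Y Delta_E /shift comp_mpoly0 mulr0. Qed.

Lemma model_rels : odd_rels e_op f_op.
Proof. exact: (odd_rels_upper X0 Y0 XYX YXY). Qed.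

Lemma model_bar_rels : odd_rels e_opbar f_opbar.
Proof. exact: (odd_rels_lower X0 Y0 XYX YXY). Qed.

Let XY i p : X i (Y i p) = 'X_i * p.
Proof.
rewrite /X /Y !DeltaV_E !Delta_E entry_ibarE entry_bariE.
rewrite !(shiftM, shiftC, shift_shift, sX, sX') !cE.
rewrite shift0 => [|l]; last by ring.
transitivity ((a i)%:MP * (a i)^-1%:MP * ('X_i * p)); last by rewrite aK mul1r.
by rewrite eqxx /=; case: (i \in S); ring.
Qed.

Let YX i p : Y i (X i p) = 'X_i * p.
Proof.
rewrite /X /Y !DeltaV_E !Delta_E entry_ibarE entry_bariE.
rewrite !(shiftM, shiftC, shift_shift, sX, sX') !cE.
rewrite shift0 => [|l]; last by ring.
transitivity ((a i)%:MP * (a i)^-1%:MP * ('X_i * p)); last by rewrite aK mul1r.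
by rewrite eqxx /=; case: (i \in S); ring.
Qed.

Lemma model_h i v : act (h_ K i) (v : sm_space (odd_supermod model_rels))
  = ('X_i * v.1, 'X_i * v.2).
Proof.
rewrite odd_act_h; apply: eqp; rewrite /= -/(X _ _) -/(Y _ _).
  by rewrite addr0; apply: XY.
by rewrite add0r; apply: YX.
Qed.

Lemma model_bar_h i v : act (h_ K i) (v : sm_space (odd_supermod model_bar_rels))
  = ('X_i * v.1, 'X_i * v.2).
Proof.
rewrite odd_act_h; apply: eqp; rewrite /= -/(X _ _) -/(Y _ _).
  by rewrite add0r; apply: YX.
by rewrite addr0; apply: XY.
Qed.

Let hact_mul e f (rels : @odd_rels K m P P e f) :
  (forall i v, act (h_ K i) (v : sm_space (odd_supermod rels)) = ('X_i * v.1, 'X_i * v.2)) ->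
  forall p (v : sm_space (odd_supermod rels)), hact p v = (p * v.1, p * v.2).
Proof.
move=> hE p v.
have itE n i (w : sm_space (odd_supermod rels)) :
    iter n (act (h_ K i)) w = ('X_i ^+ n * w.1, 'X_i ^+ n * w.2).
  elim: n => [|n IH]; first by rewrite !expr0 !mul1r; case: w.
  by rewrite iterS IH hE /= !exprS !mulrA.
have foldE (k : 'X_{1..m}) s (w : sm_space (odd_supermod rels)) :
    foldr (fun i u => iter (k i) (act (h_ K i)) u) w s
    = ((\prod_(i <- s) 'X_i ^+ k i) * w.1, (\prod_(i <- s) 'X_i ^+ k i) * w.2).
  elim: s => [|i s IH] /=; first by rewrite !big_nil !mul1r; case: w.
  by rewrite IH itE !big_cons /= !mulrA.
have monE k : hmon_act k v = ('X_[k] * v.1, 'X_[k] * v.2).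
  by rewrite /hmon_act foldE !big_enum /= -mpolyXE_id.
rewrite /hact; under eq_bigr => k _ do rewrite monE.
apply: eqp => /=.
  rewrite (raddf_sum (@fst P P)) /=.
  transitivity ((\sum_(k <- msupp p) p@_k *: 'X_[k]) * v.1); last by rewrite -mpolyE.
  rewrite mulr_suml.
  by apply: eq_bigr => k _; rewrite scalerAl.
rewrite (raddf_sum (@snd P P)) /=.
transitivity ((\sum_(k <- msupp p) p@_k *: 'X_[k]) * v.2); last by rewrite -mpolyE.
rewrite mulr_suml.
by apply: eq_bigr => k _; rewrite scalerAl.
Qed.

Let free_of e f (rels : @odd_rels K m P P e f) :
  (forall i v, act (h_ K i) (v : sm_space (odd_supermod rels)) = ('X_i * v.1, 'X_i * v.2)) ->
  forall c, free_rank1 (odd_supermod rels) c.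
Proof.
move=> /hact_mul hE c; exists (if c then (0, 1) else (1, 0)); first by case: c.
case: c => -[w0 w1] /= ->; [exists w1 | exists w0]; split;
  by rewrite ?hE /= ?mulr1 ?mulr0 // => q; rewrite hE /= mulr0 mulr1 => -[].
Qed.

Definition M_aS : M0 K m :=
  MkM0 (free_of model_h false) (free_of model_h true).

Definition Mbar_aS : M0 K m :=
  MkM0 (free_of model_bar_h false) (free_of model_bar_h true).

Lemma M_aS_ibar i (v : sm_space M_aS) :
  act (e_ibar K i) v = upper (entry_ibar i) (DeltaV_ i) v.
Proof. exact: odd_act_ibar. Qed.
Lemma M_aS_bari i (v : sm_space M_aS) :
  act (e_bari K i) v = lower (entry_bari i) (Delta_ i) v.
Proof. exact: odd_act_bari. Qed.
Lemma Mbar_aS_ibar i (v : sm_space Mbar_aS) :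
  act (e_ibar K i) v = lower (entry_ibar i) (DeltaV_ i) v.
Proof. exact: odd_act_ibar. Qed.
Lemma Mbar_aS_bari i (v : sm_space Mbar_aS) :
  act (e_bari K i) v = upper (entry_bari i) (Delta_ i) v.
Proof. exact: odd_act_bari. Qed.

End Models.

Arguments M_aS {K m} a S a_neq0.
Arguments Mbar_aS {K m} a S a_neq0.

(* Main.v *)
(* Let v_0, v_1 generate the even and the odd part. Each odd generator sends v_c
   to a U(h)-multiple of v_(1-c), so M is encoded by polynomials x_(c,i), z_(c,i)
   with e_(i \bar 1) v_c = x_(c,i) v_(1-c) and e_(\bar 1 i) v_c = z_(c,i) v_(1-c).
   Since e_(i \bar 1)^2 = 0 and K[h] is a domain, x_(0,i) or x_(1,i) vanishes; not
   both, because e_(i \bar 1) and e_(\bar 1 i) have anticommutator h_i. The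
   anticommutation of e_(i \bar 1) with e_(k \bar 1) forces the same parity c to
   have x_(c,i) = 0 for all i. What remains of the anticommutator is
   Delta_i^-1(z_(c,i)) x_(1-c,i) = h_i, and h_i is irreducible, so one factor is a
   scalar: this gives a_i and tells whether i is in S. *)
From HB Require Import structures.
Require Import Defs.
From mathcomp Require Import all_boot all_order all_algebra.
From mathcomp.multinomials Require Import ssrcomplements mpoly.
From mathcomp Require Import reals complex.

Set Implicit Arguments.
Unset Strict Implicit.
Unset Printing Implicit Defensive.

Import GRing.Theory.
Local Open Scope ring_scope.

(** * Brackets of the generators of sl(m|1) *)

Section SlRelations.
Variables (K : fieldType) (m : nat).
Implicit Types (i j k : 'I_m) (x : sl K m).

Lemma h_even i : sl_homog false (h_ K i).
Proof.
rewrite /sl_homog /mx_part -[RHS]submxK; congr block_mx; apply/matrixP=> r c;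
  by rewrite !mxE ?eq_lshift ?eq_rshift ?eq_lrshift ?eq_rlshift ?andbF ?addr0.
Qed.

Lemma e_ibar_odd i : sl_homog true (e_ibar K i).
Proof.
rewrite /sl_homog /mx_part -[RHS]submxK; congr block_mx; apply/matrixP=> r c;
  by rewrite !mxE ?eq_lshift ?eq_rshift ?eq_lrshift ?eq_rlshift ?andbF ?addr0.
Qed.

Lemma e_bari_odd i : sl_homog true (e_bari K i).
Proof.
rewrite /sl_homog /mx_part -[RHS]submxK; congr block_mx; apply/matrixP=> r c;
  by rewrite !mxE ?eq_lshift ?eq_rshift ?eq_lrshift ?eq_rlshift ?andbF ?addr0.
Qed.

Let deltaE := (mulmxDl, mulmxDr, mul_delta_mx_cond, eq_lshift, eq_rshift,
  eq_lrshift, eq_rlshift, mulr0n, mulr1n, addr0, add0r, oppr0, subr0).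

Lemma bracket_ibar_ibar i j : sl_bracket (e_ibar K i) (e_ibar K j) = 0.
Proof.
apply: val_inj; rewrite /= (sbracket_homog (e_ibar_odd i) (e_ibar_odd j)) /=.
by rewrite !deltaE scaler0 oppr0.
Qed.

Lemma bracket_bari_bari i j : sl_bracket (e_bari K i) (e_bari K j) = 0.
Proof.
apply: val_inj; rewrite /= (sbracket_homog (e_bari_odd i) (e_bari_odd j)) /=.
by rewrite !deltaE scaler0 oppr0.
Qed.

Lemma bracket_h_h i j : sl_bracket (h_ K i) (h_ K j) = 0.
Proof.
apply: val_inj; rewrite /= (sbracket_homog (h_even i) (h_even j)) /=.
rewrite !deltaE ?eqxx ?mulr1n scale1r (eq_sym j).
by have [->|_] := eqVneq i j; rewrite subrr.
Qed.

(** In [h_ K j] the unit at (j, j) contributes weight delta_ij and the one at (\bar 1, \bar 1)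
    contributes -1. They cancel exactly for j = i, which is why [DeltaV_ i] fixes ['X_i]. *)
Lemma bracket_h_ibar i j :
  sl_bracket (h_ K j) (e_ibar K i) = - (j != i)%:R *: e_ibar K i.
Proof.
apply: val_inj; rewrite /= (sbracket_homog (h_even j) (e_ibar_odd i)) /=.
rewrite !deltaE ?eqxx ?mulr1n scale1r.
by have [->|_] := eqVneq j i; rewrite /= ?subrr ?oppr0 ?scale0r ?add0r ?scaleN1r.
Qed.

Lemma bracket_h_bari i j :
  sl_bracket (h_ K j) (e_bari K i) = (j != i)%:R *: e_bari K i.
Proof.
apply: val_inj; rewrite /= (sbracket_homog (h_even j) (e_bari_odd i)) /=.
rewrite !deltaE ?eqxx ?mulr1n scale1r (eq_sym i).
by have [->|_] := eqVneq j i; rewrite /= ?subrr ?scale0r ?subr0 ?scale1r.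
Qed.

Lemma slval_bracket_ibar_bari i j : sl_bracket (e_ibar K i) (e_bari K j)
  = delta_mx (lshift 1 i) (lshift 1 j)
    + delta_mx (rshift m ord0) (rshift m ord0) *+ (i == j) :> 'M[K]_(m + 1).
Proof.
rewrite /= (sbracket_homog (e_ibar_odd i) (e_bari_odd j)) /=.
by rewrite !deltaE ?eqxx ?mulr1n expr1 scaleN1r opprK (eq_sym j).
Qed.

Lemma bracket_ibar_bari i : sl_bracket (e_ibar K i) (e_bari K i) = h_ K i.
Proof. by apply: val_inj; rewrite [LHS]slval_bracket_ibar_bari ?eqxx ?mulr1n. Qed.

Let slvalD x y : slval (x + y) = slval x + slval y.
Proof. exact: (raddfD val). Qed.

Let slvalZ c x : slval (c *: x) = c *: slval x.
Proof. exact: GRing.valZ. Qed.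

Let slval_sum (F : 'I_m -> sl K m) : slval (\sum_i F i) = \sum_i slval (F i).
Proof. exact: (big_morph _ slvalD). Qed.

(** Only the brackets with i = j have an entry at (\bar 1, \bar 1); these add up to the trace of the
    even block, which is the right entry because the supertrace of x vanishes. *)
Lemma sl_decomp x :
  x = \sum_i \sum_j slval x (lshift 1 i) (lshift 1 j)
        *: sl_bracket (e_ibar K i) (e_bari K j)
    + \sum_i slval x (lshift 1 i) (rshift m ord0) *: e_ibar K i
    + \sum_j slval x (rshift m ord0) (lshift 1 j) *: e_bari K j.
Proof.
apply: val_inj; rewrite -[LHS]/(slval _) -[RHS]/(slval _) !slvalD !slval_sum.
under [X in _ = X + _ + _]eq_bigr => i _.
  rewrite slval_sum; under eq_bigr => j _ do
    rewrite slvalZ slval_bracket_ibar_bari scalerDr.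
  over.
under [X in _ = _ + X + _]eq_bigr => i _ do rewrite slvalZ.
under [X in _ = _ + X]eq_bigr => i _ do rewrite slvalZ.
rewrite /= [LHS]matrix_sum_delta big_split_ord big_ord1 /=.
under eq_bigr => i _ do rewrite big_split_ord big_ord1 /=.
rewrite big_split_ord big_ord1 /= big_split /= addrA.
rewrite addrAC; congr (_ + _); rewrite addrAC; congr (_ + _).
under [RHS]eq_bigr => i _ do rewrite big_split /=.
rewrite big_split /=; congr (_ + _).
under [RHS]eq_bigr => i _.
  rewrite (bigD1 i) //= eqxx mulr1n big1 ?addr0 => [|j /negPf ji].
    over.
  by rewrite eq_sym ji mulr0n scaler0.
rewrite -scaler_suml; congr (_ *: _).
have := valP x; rewrite unfold_in /strace subr_eq0 /mxtrace big_ord1 => /eqP.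
under eq_bigr => i _ do rewrite !mxE.
by rewrite !mxE.
Qed.

End SlRelations.

(** * Induction on polynomials and factorizations of a variable *)

Lemma mpoly_mulX_ind (n : nat) (F : fieldType) (Q : {mpoly F[n]} -> Prop) :
    Q 1 -> (forall c p q, Q p -> Q q -> Q (c *: p + q)) ->
    (forall i p, Q p -> Q ('X_i * p)) ->
  forall p, Q p.
Proof.
move=> Q1 QD QX; elim/mpolyind => [|c k p _ _ Qp].
  (* The zero polynomial is reached as -1 *: 1 + 1. *)
  by rewrite -(addNr 1) -scaleN1r; apply: QD.
apply: QD => //; rewrite mpolyXE_id; elim: (index_enum _) => [|i s IH].
  by rewrite big_nil.
by rewrite big_cons; elim: (k i) => [|d IHd]; rewrite ?mul1r // exprS -mulrA; apply: QX.
Qed.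

(** Total degrees add over a field, so one of the factors has degree 0. In both cases [c] is the
    scalar carried by [p]. *)
Lemma mpolyX_factor (n : nat) (F : fieldType) (i : 'I_n) (p q : {mpoly F[n]}) :
    p * q = 'X_i ->
  exists2 c, c != 0 & (p = c%:MP /\ q = c^-1 *: 'X_i)
                      \/ (p = c *: 'X_i /\ q = c^-1%:MP).
Proof.
move=> pq; have : p * q != 0 by rewrite pq -msize_poly_eq0 msizeX.
rewrite mulf_eq0 negb_or => /andP [p0 q0].
have := msizeM p0 q0; rewrite pq msizeX mdeg1 => szE.
have [/msize_poly1P [c c0 pE]|sz1] := boolP (msize p == 1%N).
  exists c => //; left; split=> //.
  by rewrite -pq pE mul_mpolyC scalerA mulVf ?scale1r.
(* [msize] is the degree plus one, so the sizes of p and q sum to 3 and neither is 0. *)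
have /msize_poly1P [c c0 qE] : msize q == 1%N.
  move: p0 q0 sz1 szE; rewrite -!msize_poly_eq0.
  by case: (msize p) (msize q) => [|[|a]] [|[|b]] //=; rewrite !addSn !addnS.
exists c^-1; rewrite ?invr_eq0 //; right; rewrite invrK; split=> //.
by rewrite -pq qE mulrC mul_mpolyC scalerA mulVf ?scale1r.
Qed.

(** * The action of U(h) and its commutation with the odd generators *)

Section Action.
Variables (K : fieldType) (m : nat) (M : supermod K m).
Implicit Types (i j k : 'I_m) (x y : sl K m) (v w : sm_space M) (p q : {mpoly K[m]}).

(** [act_op] and [act_on] name the action as a function of either argument, so that each can carry a
    linear structure. *)
Definition act_op x : sm_space M -> sm_space M := act x.
HB.instance Definition _ x :=
  GRing.isLinear.Build K (sm_space M) (sm_space M) _ (act_op x) (act_linear x).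

Definition act_on v x : sm_space M := act x v.
HB.instance Definition _ v :=
  GRing.isLinear.Build K (sl K m) (sm_space M) _ (act_on v) (act_linearl v).

Lemma act_h_comm i j v :
  act (h_ K i) (act (h_ K j) v) = act (h_ K j) (act (h_ K i) v).
Proof.
have := act_bracket v (h_even K i) (h_even K j).
rewrite bracket_h_h scale1r -/(act_on v _) linear0 => /esym/eqP.
by rewrite subr_eq0 => /eqP.
Qed.

Lemma act_ibar_h i j v : act (e_ibar K i) (act (h_ K j) v)
  = act (h_ K j) (act (e_ibar K i) v) + (j != i)%:R *: act (e_ibar K i) v.
Proof.
have := act_bracket v (h_even K j) (e_ibar_odd K i).
rewrite bracket_h_ibar scale1r -/(act_on v _) linearZ /= => /esym/eqP.
rewrite subr_eq => /eqP ->.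
by rewrite scaleNr [RHS]addrC addrA subrr add0r.
Qed.

Lemma act_bari_h i j v : act (e_bari K i) (act (h_ K j) v)
  = act (h_ K j) (act (e_bari K i) v) - (j != i)%:R *: act (e_bari K i) v.
Proof.
have := act_bracket v (h_even K j) (e_bari_odd K i).
rewrite bracket_h_bari scale1r -/(act_on v _) linearZ /= => /esym/eqP.
rewrite subr_eq => /eqP ->.
by rewrite [RHS]addrC addrA addNr add0r.
Qed.

Lemma act_ibar_bari i v : act (h_ K i) v
  = act (e_ibar K i) (act (e_bari K i) v) + act (e_bari K i) (act (e_ibar K i) v).
Proof.
have := act_bracket v (e_ibar_odd K i) (e_bari_odd K i).
by rewrite bracket_ibar_bari scaleN1r opprK.
Qed.

Lemma act_ibar_ibar i j v :
  act (e_ibar K i) (act (e_ibar K j) v) + act (e_ibar K j) (act (e_ibar K i) v) = 0.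
Proof.
have := act_bracket v (e_ibar_odd K i) (e_ibar_odd K j).
by rewrite bracket_ibar_ibar scaleN1r opprK -/(act_on v _) linear0.
Qed.

Lemma act_bari_bari i j v :
  act (e_bari K i) (act (e_bari K j) v) + act (e_bari K j) (act (e_bari K i) v) = 0.
Proof.
have := act_bracket v (e_bari_odd K i) (e_bari_odd K j).
by rewrite bracket_bari_bari scaleN1r opprK -/(act_on v _) linear0.
Qed.

Lemma act_decomp x v :
  act x v = \sum_i \sum_j slval x (lshift 1 i) (lshift 1 j)
        *: (act (e_ibar K i) (act (e_bari K j) v)
            + act (e_bari K j) (act (e_ibar K i) v))
    + \sum_i slval x (lshift 1 i) (rshift m ord0) *: act (e_ibar K i) v
    + \sum_j slval x (rshift m ord0) (lshift 1 j) *: act (e_bari K j) v.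
Proof.
rewrite -[LHS]/(act_on v x) [in LHS](sl_decomp x) !linearD !linear_sum /=.
congr (_ + _ + _); apply: eq_bigr => i _; rewrite ?linearZ // linear_sum.
apply: eq_bigr => j _; rewrite linearZ; congr (_ *: _).
by rewrite [LHS](act_bracket v (e_ibar_odd K i) (e_bari_odd K j)) scaleN1r opprK.
Qed.

Lemma hmon_act_linear (k : 'X_{1..m}) : linear (@hmon_act K m M k).
Proof.
move=> c v w; rewrite /hmon_act; elim: (enum _) => //= i s ->.
by elim: (k i) => //= n ->; apply: act_linear.
Qed.

Lemma hmon_act0 v : hmon_act 0%MM v = v.
Proof. by rewrite /hmon_act; elim: (enum _) => //= i s ->; rewrite mnm0E. Qed.

Lemma iter_h_comm i j n v :
  iter n (act (h_ K i)) (act (h_ K j) v) = act (h_ K j) (iter n (act (h_ K i)) v).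
Proof. by elim: n => //= n ->; apply: act_h_comm. Qed.

(** The new factor [h_ K i] appears inside a product taken in the order of the enumeration. It
    occurs there once, as the enumeration has no repetition, and moves to the front because the
    [h_ K j] commute. *)
Lemma hmon_act_mulX (k : 'X_{1..m}) i v :
  hmon_act (U_(i) + k)%MM v = act (h_ K i) (hmon_act k v).
Proof.
rewrite /hmon_act; have := enum_uniq 'I_m.
have : i \in enum 'I_m by rewrite mem_enum.
elim: (enum _) => //= j s IH.
have E r : i \notin r ->
  foldr (fun l => iter ((U_(i) + k)%MM l) (act (h_ K l))) v r
  = foldr (fun l => iter (k l) (act (h_ K l))) v r.
  elim: r => //= l r IHr; rewrite inE negb_or => /andP [il /IHr ->].
  by rewrite mnmDE mnm1E (negPf il).
rewrite inE => /orP [/eqP <-|si] /andP [ns us].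
  by rewrite E // mnmDE mnm1E eqxx.
rewrite IH // mnmDE mnm1E; case: eqP ns => [<-|_ _]; first by rewrite si.
by rewrite add0n iter_h_comm.
Qed.

(** The support depends on p; a common index set of bounded monomials allows sums for different
    polynomials to be added termwise. *)
Lemma hactE n p v : (msize p <= n)%N ->
  hact p v = \sum_(k : 'X_{1..m < n}) p@_k *: hmon_act k v.
Proof.
move=> le_pn; pose I : subFinType _ := 'X_{1..m < n}.
rewrite /hact (big_mksub I) ?msupp_uniq //=; first last.
  by move=> k /msize_mdeg_lt /leq_trans; apply.
by rewrite big_rmcond //= => k /memN_msupp_eq0 ->; rewrite scale0r.
Qed.

Lemma hact_linearl v : linear (@hact K m M ^~ v).
Proof.
move=> c p q; pose n := maxn (msize (c *: p + q)) (maxn (msize p) (msize q)).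
rewrite !(@hactE n) ?leq_max ?leqnn ?orbT // scaler_sumr -big_split /=.
by apply: eq_bigr => k _; rewrite mcoeffD mcoeffZ scalerDl scalerA.
Qed.

Lemma hact_linear p : linear (@hact K m M p).
Proof.
move=> c v w; rewrite /hact scaler_sumr -big_split /=.
by apply: eq_bigr => k _; rewrite hmon_act_linear scalerDr !scalerA mulrC.
Qed.

Definition hact_on v p : sm_space M := hact p v.
HB.instance Definition _ v :=
  GRing.isLinear.Build K {mpoly K[m]} (sm_space M) _ (hact_on v) (hact_linearl v).
HB.instance Definition _ p :=
  GRing.isLinear.Build K (sm_space M) (sm_space M) _ (@hact K m M p) (hact_linear p).

Lemma hact_monom (k : 'X_{1..m}) v : hact 'X_[k] v = hmon_act k v.
Proof. by rewrite /hact msuppX big_seq1 mcoeffX eqxx scale1r. Qed.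

Lemma hactDl p q v : hact (p + q) v = hact p v + hact q v.
Proof. exact: (linearD (hact_on v)). Qed.

Lemma hact0l v : hact 0 v = 0.
Proof. exact: (linear0 (hact_on v)). Qed.

Lemma hactZl c p v : hact (c *: p) v = c *: hact p v.
Proof. exact: (linearZ_LR (hact_on v)). Qed.

Lemma hact1 v : hact 1 v = v.
Proof. by rewrite -mpolyX0 hact_monom hmon_act0. Qed.

Lemma hact_XM i p v : hact ('X_i * p) v = act (h_ K i) (hact p v).
Proof.
elim/mpolyind: p => [|c k p _ _ IH].
  by rewrite mulr0 !hact0l -/(act_op _ _) linear0.
rewrite mulrDr !hactDl IH -!/(act_op _ _) linearD; congr (_ + _).
by rewrite -scalerAr -mpolyXD !hactZl !hact_monom hmon_act_mulX linearZ.
Qed.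

Lemma hactM p q v : hact (p * q) v = hact p (hact q v).
Proof.
elim/mpoly_mulX_ind: p => [|c p1 p2 IH1 IH2|i p IH].
- by rewrite mul1r hact1.
- by rewrite mulrDl -scalerAl !hactDl !hactZl IH1 IH2.
- by rewrite -mulrA !hact_XM IH.
Qed.

(** The hypothesis says that u h_j = (h_j - d_j) u, and h_j - d_j is the image of ['X_j] under the
    algebra map [shift d]. This is the source of the twists [Delta_ i] and [DeltaV_ i]. *)
Lemma semilinear_hact (u : sm_space M -> sm_space M) (d : 'I_m -> K) :
    linear u -> (forall j v, u (act (h_ K j) v) = act (h_ K j) (u v) - d j *: u v) ->
  forall p v, u (hact p v) = hact (shift d p) (u v).
Proof.
move=> u_lin u_h p; elim/mpoly_mulX_ind: p => [|c p q IHp IHq|i p IHp] v.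
- by rewrite -{2}mpolyC1 shiftC mpolyC1 !hact1.
- by rewrite shift_linear !hactDl !hactZl u_lin IHp IHq.
rewrite shiftM shiftX mulrBl mul_mpolyC hact_XM u_h IHp.
by rewrite -scaleN1r -[_ + _]addrC hactDl -scaleNr hactZl hact_XM scalerA mulN1r addrC.
Qed.

Lemma act_ibar_hact i p v :
  act (e_ibar K i) (hact p v) = hact (DeltaV_ i p) (act (e_ibar K i) v).
Proof.
rewrite DeltaV_E; apply: semilinear_hact; first exact: act_linear.
by move=> j w; rewrite act_ibar_h scaleNr opprK.
Qed.

Lemma act_bari_hact i p v :
  act (e_bari K i) (hact p v) = hact (Delta_ i p) (act (e_bari K i) v).
Proof.
by rewrite Delta_E; apply: semilinear_hact; [exact: act_linear | exact: act_bari_h].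
Qed.

Lemma vhomog_linear c (a : K) v w :
  vhomog c v -> vhomog c w -> vhomog c (a *: v + w : sm_space M).
Proof. by case: c => /= -> ->; rewrite scaler0 addr0. Qed.

Lemma hact_homog c p v : vhomog c v -> vhomog c (hact p v).
Proof.
move=> hv; elim/mpoly_mulX_ind: p => [|a p q IHp IHq|i p IHp].
- by rewrite hact1.
- by rewrite hactDl hactZl; apply: vhomog_linear.
- by rewrite hact_XM; apply: (act_parity (h_even K i) IHp).
Qed.

End Action.

Lemma shift_zero (K : fieldType) (m : nat) (d : 'I_m -> K) : shift d 0 = 0.
Proof. exact: comp_mpoly0. Qed.

(** Shifting by the opposite amounts inverts [shift d]. *)
Lemma shift_eq0 (K : fieldType) (m : nat) (d : 'I_m -> K) (p : {mpoly K[m]}) :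
  (shift d p == 0) = (p == 0).
Proof.
apply/eqP/eqP => [p0|->]; last exact: shift_zero.
rewrite -[p](@shift0 _ _ (fun j => - d j + d j)) => [|j]; last by rewrite addNr.
by rewrite -shift_shift p0 shift_zero.
Qed.

(** * Intertwining maps and isomorphisms *)

Section Homomorphisms.
Variables (K : fieldType) (m : nat).

(** By [act_decomp] every operator [act x] is built from those of the odd generators. *)
Lemma intertwine_odd (M N : supermod K m) (g : sm_space M -> sm_space N) :
    linear g ->
    (forall i v, g (act (e_ibar K i) v) = act (e_ibar K i) (g v)) ->
    (forall i v, g (act (e_bari K i) v) = act (e_bari K i) (g v)) ->
  forall x v, g (act x v) = act x (g v).
Proof.
move=> g_lin ge gf x v; pose u : {linear sm_space M -> sm_space N} :=
  HB.pack g (GRing.isLinear.Build _ _ _ _ g g_lin).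
have uE w : u w = g w by [].
rewrite -uE !act_decomp !linearD !linear_sum.
congr (_ + _ + _); apply: eq_bigr => i _; last 2 first.
- by rewrite linearZ uE ge.
- by rewrite linearZ uE gf.
rewrite linear_sum; apply: eq_bigr => j _.
by rewrite linearZ linearD !uE ge gf gf ge.
Qed.

Lemma vhomog_eq0 (V0 V1 : lmodType K) c (v : (V0 * V1)%type) :
  vhomog c v -> vhomog (~~ c) v -> v = 0.
Proof. by case: c v => -[a b] /= -> ->. Qed.

Lemma vhomog_decomp (V0 V1 : lmodType K) c (v : (V0 * V1)%type) :
  exists v1 v2 : (V0 * V1)%type, [/\ vhomog c v1, vhomog (~~ c) v2 & v = v1 + v2].
Proof.
case: v => a b; exists (if c then (0, b) else (a, 0)), (if c then (a, 0) else (0, b)).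
by case: c; split=> //; congr pair; rewrite /= ?addr0 ?add0r.
Qed.

(** Injectivity of [g] transfers its properties to the inverse. The map starts from N because N will
    be a model, whose elements are coordinates of vectors of M. *)
Lemma M0iso_intertwine (M N : M0 K m) (g : sm_space N -> sm_space M) :
    linear g -> (forall c u, vhomog c u -> vhomog c (g u)) ->
    injective g -> (forall w, exists u, g u = w) ->
    (forall i u, g (act (e_ibar K i) u) = act (e_ibar K i) (g u)) ->
    (forall i u, g (act (e_bari K i) u) = act (e_bari K i) (g u)) ->
  M0iso M N.
Proof.
move=> g_lin g_homog g_inj g_surj ge gf.
have g_act := intertwine_odd g_lin ge gf.
(* Boolean equality lets [xchoose] select a preimage. *)
have g_surjb w : exists u, g u == w by have [u <-] := g_surj w; exists u.
pose f w := xchoose (g_surjb w).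
have fK : cancel f g by move=> w; apply/eqP/(xchooseP (g_surjb w)).
have gK : cancel g f by move=> u; apply: g_inj; rewrite fK.
have f_lin : linear f by move=> c u w; apply: g_inj; rewrite g_lin !fK.
have f_act x w : f (act x w) = act x (f w) by apply: g_inj; rewrite g_act !fK.
(* The component of [f w] of the wrong parity has an image that is homogeneous of both parities,
   hence zero. *)
have f_even c w : vhomog c w -> vhomog c (f w).
  have [u1 [u2 [h1 h2 uE]]] := vhomog_decomp c (f w); rewrite uE => hw.
  have gD : g u2 = -1 *: g u1 + w.
    have := g_lin 1 u1 u2; rewrite !scale1r -uE fK => ->.
    by rewrite scaleN1r addKr.
  have : g u2 = 0.
    apply: (vhomog_eq0 (c := c)); last exact: g_homog.
    by rewrite gD; apply: vhomog_linear => //; apply: g_homog.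
  have g0 : g 0 = 0.
    by have := g_lin (-1) 0 0; rewrite scaler0 add0r scaleN1r addNr.
  by rewrite -g0 => /g_inj ->; rewrite addr0.
by exists (MkM0hom f_lin f_even f_act), (MkM0hom g_lin g_homog g_act).
Qed.

End Homomorphisms.

(** * The odd generators in a homogeneous basis *)

Section FreeBasis.
Variables (K : fieldType) (m : nat) (M : supermod K m) (v : bool -> sm_space M).
Hypothesis v_homog : forall c, vhomog c (v c).
Hypothesis v_free : forall c (w : sm_space M), vhomog c w ->
  exists! p : {mpoly K[m]}, hact p (v c) = w.
Local Notation P := {mpoly K[m]}.

Lemma hact_basis_inj c : injective (fun p : P => hact p (v c)).
Proof.
move=> p q /= eq_pq; have [r [_ uniq_r]] := v_free (hact_homog q (v_homog c)).
by rewrite -(uniq_r _ eq_pq) -(uniq_r q).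
Qed.

Lemma odd_entries (u : 'I_m -> sl K m) : (forall i, sl_homog true (u i)) ->
  exists x : bool * 'I_m -> P,
    forall c i, act (u i) (v c) = hact (x (c, i)) (v (~~ c)).
Proof.
move=> u_odd.
(* The index set is finite, so all entries can be chosen at once. *)
have /fin_all_exists [x xE] : forall ci : bool * 'I_m, exists p : P,
    act (u ci.2) (v ci.1) = hact p (v (~~ ci.1)).
  move=> [c i] /=; have [p [pE _]] := v_free (act_parity (u_odd i) (v_homog c)).
  by exists p.
by exists x => c i; apply: (xE (c, i)).
Qed.

Let eDV := (DeltaV_E, shift_eq0).
Let eD := (Delta_E, shift_eq0).

(** [c] is the parity killed by every [e_ibar K i]. It is read off at [i0] and then spread to the
    other indices. *)
Lemma basis_structure (i0 : 'I_m) : (2%:R : K) != 0 ->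
  exists c (a : 'I_m -> K) (S : {set 'I_m}), (forall i, a i != 0) /\ forall i,
    [/\ act (e_ibar K i) (v c) = 0,
        act (e_ibar K i) (v (~~ c)) = hact (entry_ibar a S i) (v c),
        act (e_bari K i) (v (~~ c)) = 0
      & act (e_bari K i) (v c) = hact (entry_bari a S i) (v (~~ c))].
Proof.
move=> two_neq0.
have [x xE] := odd_entries (@e_ibar_odd K m); have [z zE] := odd_entries (@e_bari_odd K m).
(* The relations among generators, applied to [v c], become polynomial identities by comparing
   coefficients; the outer generator twists the coefficient it passes. *)
have xx c i k : DeltaV_ i (x (c, k)) * x (~~ c, i) + DeltaV_ k (x (c, i)) * x (~~ c, k) = 0.
  apply: (@hact_basis_inj c); rewrite /= hact0l -(act_ibar_ibar i k (v c)).
  by rewrite !xE !act_ibar_hact !xE negbK -!hactM -hactDl.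
have zz c i k : Delta_ i (z (c, k)) * z (~~ c, i) + Delta_ k (z (c, i)) * z (~~ c, k) = 0.
  apply: (@hact_basis_inj c); rewrite /= hact0l -(act_bari_bari i k (v c)).
  by rewrite !zE !act_bari_hact !zE negbK -!hactM -hactDl.
have xz c i : DeltaV_ i (z (c, i)) * x (~~ c, i) + Delta_ i (x (c, i)) * z (~~ c, i) = 'X_i.
  apply: (@hact_basis_inj c); rewrite -['X_i]mulr1 /= hact_XM hact1 act_ibar_bari.
  by rewrite xE zE act_ibar_hact act_bari_hact xE zE negbK -!hactM -hactDl.
(* For i = k the relations [xx] and [zz] give only twice the square of a generator. *)
have double0 (p : P) : p + p = 0 -> p = 0.
  move/eqP; rewrite -mulr2n -scaler_nat scaler_eq0 (negPf two_neq0) => /eqP //.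
have X_neq0 i : 'X_i != 0 :> P by rewrite -msize_poly_eq0 msizeX.
have x_eq0 c i : x (c, i) = 0 \/ x (~~ c, i) = 0.
  by have /double0/eqP := xx c i i; rewrite mulf_eq0 !eDV => /orP [] /eqP; [left | right].
have z_eq0 c i : z (c, i) = 0 \/ z (~~ c, i) = 0.
  by have /double0/eqP := zz c i i; rewrite mulf_eq0 !eD => /orP [] /eqP; [left | right].
have xN_neq0 c i : x (c, i) = 0 -> x (~~ c, i) != 0.
  move=> xc0; apply: contraNneq (X_neq0 i) => xN0; rewrite -(xz c) xc0 xN0.
  by rewrite Delta_E shift_zero mulr0 mul0r addr0.
have [c xc0] : exists c, x (c, i0) = 0.
  by have [] := x_eq0 true i0; [exists true | exists false].
(* In the relation between [i0] and [i] the term with [x (c, i0)] drops out, and the cofactor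
   [x (~~ c, i0)] of the other term is nonzero. *)
have {}xc0 i : x (c, i) = 0.
  have /eqP := xx c i0 i; rewrite xc0 [DeltaV_ i 0]DeltaV_E shift_zero mul0r addr0.
  rewrite mulf_eq0 !eDV => /orP [/eqP //|].
  by rewrite (negPf (xN_neq0 c i0 xc0)).
have zx i : DeltaV_ i (z (c, i)) * x (~~ c, i) = 'X_i.
  by rewrite -(xz c) xc0 Delta_E shift_zero mul0r addr0.
have zN0 i : z (~~ c, i) = 0.
  have [zc0|//] := z_eq0 c i; have := X_neq0 i.
  by rewrite -zx zc0 DeltaV_E shift_zero mul0r eqxx.
(* The pair records a_i and whether i lies in S. *)
have /fin_all_exists2 [as_ as0 asE] : forall i, exists2 as_ : K * bool, as_.1 != 0 &
    x (~~ c, i) = (if as_.2 then as_.1 *: 'X_i else as_.1%:MP) /\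
    z (c, i) = (if as_.2 then (as_.1^-1)%:MP else as_.1^-1 *: 'X_i).
  move=> i; have shiftXi d : d i = 0 -> shift d 'X_i = 'X_i.
    by move=> di; rewrite shiftX di mpolyC0 subr0.
  have [b b0 H] := mpolyX_factor (zx i).
  have zE' : z (c, i) = Delta_ i (DeltaV_ i (z (c, i))) by rewrite DeltaV_K.
  (* [b] is the scalar of the factor coming from z, so a_i is its inverse; i is in S when that
     factor is constant. Undoing the twist changes nothing, since [Delta_ i] fixes constants and
     ['X_i]. *)
  case: H => -[tzE ->]; [exists (b^-1, true) | exists (b^-1, false)];
    rewrite /= ?invr_eq0 ?invrK //; split=> //; rewrite zE' tzE Delta_E.
    exact: shiftC.
  by rewrite -mul_mpolyC shiftM shiftC shiftXi ?eqxx // mul_mpolyC.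
exists c, (fun i => (as_ i).1), [set i | (as_ i).2]; split=> // i.
by have [xiE ziE] := asE i; rewrite !xE !zE !negbK xc0 zN0 !hact0l xiE ziE
  /entry_ibar /entry_bari inE.
Qed.

(** This coordinate map will be the isomorphism from the model to M. *)
Definition basis_comb (u : P * P) : sm_space M :=
  hact u.1 (v false) + hact u.2 (v true).

Lemma basis_comb_linear : linear basis_comb.
Proof.
by move=> k u w; rewrite /basis_comb /= !hactDl !hactZl scalerDr addrACA.
Qed.

Lemma basis_comb_homog c (u : P * P) : vhomog c u -> vhomog c (basis_comb u).
Proof.
rewrite /basis_comb; case: c u => -[p q]; rewrite {1}/vhomog /= => ->.
  by rewrite hact0l add0r; apply: hact_homog (v_homog true).
by rewrite hact0l addr0; apply: hact_homog (v_homog false).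
Qed.

(** The two summands have opposite parities, so the equation splits into one for each basis
    vector. *)
Lemma basis_comb_inj : injective basis_comb.
Proof.
move=> [p q] [p' q']; rewrite /basis_comb /= => E.
have h0 r : (hact r (v false)).2 = 0 := hact_homog r (v_homog false).
have h1 r : (hact r (v true)).1 = 0 := hact_homog r (v_homog true).
congr pair.
  apply: (@hact_basis_inj false); move: (congr1 fst E) => /=.
  rewrite !h1 !addr0 => E1; move: (h0 p) (h0 p') E1.
  by case: (hact p _) (hact p' _) => [? ?] [? ?] /= -> -> ->.
apply: (@hact_basis_inj true); move: (congr1 snd E) => /=.
rewrite !h0 !add0r => E2; move: (h1 q) (h1 q') E2.
by case: (hact q _) (hact q' _) => [? ?] [? ?] /= -> -> ->.
Qed.

Lemma basis_comb_surj w : exists u, basis_comb u = w.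
Proof.
have [w1 [w2 [h1 h2 ->]]] := vhomog_decomp false w.
have [p [pE _]] := v_free h1; have [q [qE _]] := v_free h2.
by exists (p, q); rewrite /basis_comb /= pE qE.
Qed.

Lemma act_ibar_basis_comb i u : act (e_ibar K i) (basis_comb u)
  = hact (DeltaV_ i u.1) (act (e_ibar K i) (v false))
    + hact (DeltaV_ i u.2) (act (e_ibar K i) (v true)).
Proof. by rewrite -!act_ibar_hact -!/(act_op _ _) linearD. Qed.

Lemma act_bari_basis_comb i u : act (e_bari K i) (basis_comb u)
  = hact (Delta_ i u.1) (act (e_bari K i) (v false))
    + hact (Delta_ i u.2) (act (e_bari K i) (v true)).
Proof. by rewrite -!act_bari_hact -!/(act_op _ _) linearD. Qed.

End FreeBasis.

(** * Classification of the objects *)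

Lemma M0_classification (K : fieldType) (m : nat) (M : M0 K m) (i0 : 'I_m) :
    (2%:R : K) != 0 ->
  exists (a : 'I_m -> K) (ha : forall i, a i != 0) (S : {set 'I_m}),
    M0iso M (M_aS a S ha) \/ M0iso M (Mbar_aS a S ha).
Proof.
move=> two_neq0; have [v0 v0h v0free] := M0_even M; have [v1 v1h v1free] := M0_odd M.
pose v c := if c then v1 else v0.
have v_homog c : vhomog c (v c) by case: c.
have v_free c (w : sm_space M) : vhomog c w ->
    exists! p : {mpoly K[m]}, hact p (v c) = w.
  by case: c; [apply: v1free | apply: v0free].
have [c [a [S [ha vE]]]] := basis_structure v_homog v_free i0 two_neq0.
exists a, ha, S.
have lin := basis_comb_linear v; have par := basis_comb_homog v_homog.
have inj := basis_comb_inj v_homog v_free; have surj := basis_comb_surj v_free.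
(* In the barred model [e_ibar K i] kills the odd part, in the other one the even part. *)
case: c vE => /= vE;
  [right; apply: (@M0iso_intertwine _ _ M (Mbar_aS a S ha) (basis_comb v))
  | left; apply: (@M0iso_intertwine _ _ M (M_aS a S ha) (basis_comb v))] => // i u;
  have [e1 e0 f1 f0] := vE i.
- rewrite act_ibar_basis_comb /v e1 e0 Mbar_aS_ibar.
  by rewrite /basis_comb /lower /= hact0l linear0 addr0 add0r mulrC hactM.
- rewrite act_bari_basis_comb /v f1 f0 Mbar_aS_bari.
  by rewrite /basis_comb /upper /= hact0l linear0 addr0 add0r mulrC hactM.
- rewrite act_ibar_basis_comb /v e1 e0 M_aS_ibar.
  by rewrite /basis_comb /upper /= hact0l linear0 addr0 add0r mulrC hactM.
- rewrite act_bari_basis_comb /v f1 f0 M_aS_bari.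
  by rewrite /basis_comb /lower /= hact0l linear0 addr0 add0r mulrC hactM.
Qed.

Theorem proposition4p15 (R : realType) (m : nat) (hm : (2 <= m)%N)
    (M : M0 R[i] m) :
  exists (a : 'I_m -> R[i]) (ha : forall i, a i != 0) (S : {set 'I_m}),
    M0iso M (M_aS a S ha) \/ M0iso M (Mbar_aS a S ha).
Proof.
(* [ltnW hm] proves 0 < m, so the starting index is the first one. *)
apply: (M0_classification M (Ordinal (ltnW hm))).
by rewrite Num.Theory.pnatr_eq0.
Qed.
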